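(* Let $M$ be a square complex matrix of size $n$. (a) If $M$ is traceless, then $M$ is antidiagonalizable if and only if $M$ is hollow-quasidiagonalizable; and $M$ is permutation- (respectively orthogonally, unitarily) antidiagonalizable if and only if $M$ is permutation- (respectively orthogonally, unitarily) hollow-quasidiagonalizable. For general $M$ (not necessarily traceless), $M$ is antidiagonalizable if and only if $M$ is Q-pseudo-hollow-quasidiagonalizable; and $M$ is permutation- (respectively orthogonally, unitarily) antidiagonalizable if and only if $M$ is permutation- (respectively orthogonally, unitarily) Q-pseudo-hollow-quasidiagonalizable. (b) $M$ is antidiagonalizable if and only if $M$ is similar to a direct sum of hollow $2\times2$ matrices, with one additional $1\times1$ matrix as a summand if $n$ is odd. $M$ is permutation- (respectively orthogonally, unitarily) antidiagonalizable if and only if $M$ is permutation- (respectively orthogonally, unitarily) similar to a direct sum of hollow $2\times2$ matrices, with one additional $1\times1$ matrix as a summand if $n$ is odd.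
   Context: $M$ and $N$ are similar if $M=VNV^{-1}$ for a nonsingular $V$, and permutation-/orthogonally/unitarily similar if $V$ can be taken to be a permutation/orthogonal/unitary matrix. An antidiagonal matrix of size $n$ has nonzero entries only at positions $(i,n+1-i)$. A matrix is hollow if its main diagonal is zero, and quasidiagonal if it is block diagonal with square diagonal blocks of size at most $2$. For a class of matrices $X$ (antidiagonal; hollow quasidiagonal; Q-pseudo-hollow quasidiagonal), $M$ is ''$X$-izable'' (antidiagonalizable; hollow-quasidiagonalizable; Q-pseudo-hollow-quasidiagonalizable) if it is similar to a matrix in the class, and permutation-/orthogonally/unitarily so if the similarity can be taken permutation/orthogonal/unitary. A matrix is Q-pseudo-hollow quasidiagonal if it is of the form $\bigoplus_{j=1}^{m}\begin{pmatrix}0&p_j\\ q_j&0\end{pmatrix}$ when $n=2m$, or $(c)\oplus\bigoplus_{j=1}^{m}\begin{pmatrix}0&p_j\\ q_j&0\end{pmatrix}$ when $n=2m+1$, with arbitrary complex $c,p_j,q_j$. *)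

(* Defs.v *)
From mathcomp Require Import all_boot all_order all_algebra.
From mathcomp Require Import reals.
From mathcomp.real_closed Require Export complex.

Set Implicit Arguments.
Unset Strict Implicit.
Unset Printing Implicit Defensive.

Import Order.TTheory GRing.Theory Num.Theory.
Local Open Scope ring_scope.

Section Classes.
Variable C : numClosedFieldType.

(* Indices are 0-based: position (i, n+1-i) is (i, rev_ord i). *)
Definition antidiagonal n (A : 'M[C]_n) : Prop :=
  forall i j : 'I_n, j != rev_ord i -> A i j = 0.

Definition hollow n (A : 'M[C]_n) : Prop := forall i : 'I_n, A i i = 0.

Definition quasidiagonal n (A : 'M[C]_n) : Prop :=
  exists (k : nat) (p : 'I_k -> nat) (B : forall i, 'M[C]_(p i))
         (e : (\sum_i p i)%N = n),
    (forall i, (0 < p i <= 2)%N) /\ A = castmx (e, e) (\mxdiag_i B i).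

Definition hollow_quasidiagonal n (A : 'M[C]_n) : Prop :=
  hollow A /\ quasidiagonal A.

Definition hollow2 (p q : C) : 'M[C]_(1 + 1) := block_mx 0 p%:M q%:M 0.

Definition Qpseudo_hollow_quasidiagonal n (A : 'M[C]_n) : Prop :=
  (exists (m : nat) (p q : 'I_m -> C) (e : (\sum_(j < m) 2)%N = n),
     A = castmx (e, e) (\mxdiag_(j < m) hollow2 (p j) (q j)))
  \/
  (exists (m : nat) (c : C) (p q : 'I_m -> C)
          (e : (1 + \sum_(j < m) 2)%N = n),
     A = castmx (e, e)
           (block_mx c%:M 0 0 (\mxdiag_(j < m) hollow2 (p j) (q j)))).

(* The 1 x 1 summand, present exactly when n is odd, is arbitrary and may
   stand anywhere among the summands. *)
Definition sum_of_hollow2 n (A : 'M[C]_n) : Prop :=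
  exists (k : nat) (p : 'I_k -> nat) (B : forall i, 'M[C]_(p i))
         (e : (\sum_i p i)%N = n),
    [/\ forall i, p i = 1%N \/ (p i = 2%N /\ hollow (B i)),
        #|[set i | p i == 1%N]| = odd n
      & A = castmx (e, e) (\mxdiag_i B i)].

Definition orthogonalmx n : pred 'M[C]_n := fun V => V *m V^T == 1%:M.

Definition real_orthogonalmx n : pred 'M[C]_n :=
  fun V => (V \is a mxOver Num.real) && orthogonalmx V.

Definition similar_to n (S : pred 'M[C]_n) (X : 'M[C]_n -> Prop)
    (M : 'M[C]_n) : Prop :=
  exists V N : 'M[C]_n, [/\ S V, X N & M = V *m N *m invmx V].

Definition izable n (X : 'M[C]_n -> Prop) := similar_to (fun V => V \in unitmx) X.

Definition permutation_izable n (X : 'M[C]_n -> Prop) :=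
  similar_to (@is_perm_mx C n) X.

Definition orthogonally_izable n (X : 'M[C]_n -> Prop) :=
  similar_to (@orthogonalmx n) X.

Definition real_orthogonally_izable n (X : 'M[C]_n -> Prop) :=
  similar_to (@real_orthogonalmx n) X.

Definition unitarily_izable n (X : 'M[C]_n -> Prop) :=
  similar_to (fun V => V \is spectral.unitarymx) X.

End Classes.

(* "Orthogonal" for complex matrices may mean V *m V^T = 1 with complex or with
   real entries; both versions are asserted. *)
Definition same_izability (C : numClosedFieldType) n (X Y : 'M[C]_n -> Prop)
    (M : 'M[C]_n) : Prop :=
  [/\ izable X M <-> izable Y M,
      permutation_izable X M <-> permutation_izable Y M,
      real_orthogonally_izable X M <-> real_orthogonally_izable Y M,
      orthogonally_izable X M <-> orthogonally_izable Y M
    & unitarily_izable X M <-> unitarily_izable Y M].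

(* Main.v *)
(* Every matrix in each of the four classes is supported on the graph of an
   involution of the indices with at most one fixed point: the reversal for
   antidiagonal matrices, the reversal inside each block for sums of hollow
   blocks; in a hollow quasidiagonal matrix the 1 x 1 blocks vanish, so they can
   be paired off. Two involutions of n indices with at most one fixed point
   have the same number of fixed points, hence are conjugate, so a permutation
   similarity carries one support to the other. All the similarity groups
   contain the permutation matrices. *)

Require Import Defs.
From mathcomp Require Import all_boot all_order all_algebra all_fingroup.
From mathcomp Require Import zify.
From mathcomp Require Import reals.
From mathcomp.real_closed Require Import complex.

Set Implicit Arguments.
Unset Strict Implicit.
Unset Printing Implicit Defensive.

Import GRing.Theory Num.Theory tagnat.
Local Open Scope ring_scope.

(** * Counting and conjugating involutions *)

Lemma card_transport (T : finType) (P Q : pred T) : #|P| = #|Q| ->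
  exists f : T -> T,
    {in P &, injective f} /\ (forall x, x \in P -> f x \in Q).
Proof.
(* An element of [P] goes to the element of [Q] at the same place in the enumeration; on [P] the
   default [x] of [nth] is never reached. *)
move=> ePQ; exists (fun x => nth x (enum Q) (index x (enum P))).
have ltQ x : x \in P -> (index x (enum P) < size (enum Q))%N.
  by move=> Px; rewrite -cardE -ePQ cardE index_mem mem_enum.
split=> [x y Px Py /eqP|x Px]; last by rewrite -(mem_enum Q) mem_nth ?ltQ.
rewrite (set_nth_default x y) ?ltQ// nth_uniq ?enum_uniq ?ltQ// => /eqP eq_xy.
by apply: (index_inj x _ _ eq_xy); rewrite mem_enum.
Qed.

(** [s] exchanges the points below their image with those above it, so these two sets have the same
    size. *)
Lemma card_involution n (s : 'I_n -> 'I_n) : involutive s ->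
  n = (#|[pred x | s x == x]| + #|[pred x : 'I_n | (x < s x)%N]|.*2)%N.
Proof.
move=> sK; rewrite -addnn -[LHS]card_ord -!sum1_card.
rewrite [X in (_ + (_ + X))%N](reindex_inj (inv_inj sK))/=.
rewrite [X in (X + _)%N]big_mkcond [X in (_ + (X + _))%N]big_mkcond.
rewrite [X in (_ + (_ + X))%N]big_mkcond -!big_split/=; apply: eq_bigr => x _.
by rewrite !inE sK -val_eqE; case: ltngtP.
Qed.

(** A conjugating permutation can be chosen freely as a bijection between the fixed points and
    between the smaller elements of the 2-cycles; its value at the larger element of a 2-cycle is
    then forced. *)
Lemma involution_conj n (s t : 'I_n -> 'I_n) :
  involutive s -> involutive t ->
  #|[pred x | s x == x]| = #|[pred x | t x == x]| ->
  exists w : 'S_n, forall x, w (s x) = t (w x).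
Proof.
move=> sK tK eF.
have eA : #|[pred x : 'I_n | (x < s x)%N]| = #|[pred x : 'I_n | (x < t x)%N]|.
  apply: double_inj; apply: (@addnI #|[pred x | s x == x]|).
  by rewrite -card_involution// eF -card_involution.
have [f [fI fP]] := card_transport eA.
have [g [gI gP]] := card_transport eF.
pose w (x : 'I_n) :=
  if (x < s x)%N then f x else if (s x < x)%N then t (f (s x)) else g x.
have wst x : w (s x) = t (w x).
  rewrite /w sK; case: ltngtP => [_|_|/val_inj sx]; rewrite ?tK//.
  by have := gP x; rewrite !inE sx eqxx => /(_ isT) /eqP ->.
have w_lt (x : 'I_n) : (x < s x)%N -> (w x < t (w x))%N.
  by move=> xs; rewrite /w xs; have := fP x; rewrite !inE; apply.
have w_gt (x : 'I_n) : (s x < x)%N -> (t (w x) < w x)%N.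
  by move=> xs; have := w_lt (s x); rewrite sK wst tK; apply.
have w_eq x : s x = x -> t (w x) = w x by move=> sx; rewrite -wst sx.
(* [w] preserves the order between a point and its image, so two points with equal images fall in
   the same case of the definition of [w]. *)
have wI : injective w.
  move=> x y exy; have := exy; rewrite {1 2}/w.
  case: (ltngtP x (s x)) => [xs|xs|/val_inj/esym xs];
    case: (ltngtP y (s y)) => [ys|ys|/val_inj/esym ys].
  - exact: fI.
  - by have := w_lt _ xs; rewrite exy ltnNge ltnW// w_gt.
  - by have := w_lt _ xs; rewrite exy w_eq// ltnn.
  - by have := w_lt _ ys; rewrite -exy ltnNge ltnW// w_gt.
  - by move=> /(inv_inj tK) /fI; rewrite !inE !sK => /(_ xs ys) /(inv_inj sK).
  - by have := w_gt _ xs; rewrite exy w_eq// ltnn.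
  - by have := w_lt _ ys; rewrite -exy w_eq// ltnn.
  - by have := w_gt _ ys; rewrite -exy w_eq// ltnn.
  - by apply: gI; rewrite !inE ?xs ?ys.
by exists (perm wI) => x; rewrite !permE.
Qed.

Definition near_matching n (s : 'I_n -> 'I_n) : Prop :=
  involutive s /\ (#|[pred x | s x == x]| <= 1)%N.

(** The number of fixed points has the parity of [n]; being at most one, it equals [odd n] for both
    involutions. *)
Lemma near_matching_conj n (s t : 'I_n -> 'I_n) :
  near_matching s -> near_matching t ->
  exists w : 'S_n, forall x, w (s x) = t (w x).
Proof.
have card_fix u : near_matching u -> #|[pred x : 'I_n | u x == x]| = odd n.
  case=> uK le1; have := congr1 odd (card_involution uK).
  by rewrite oddD odd_double addbF => ->; move: le1; case: #|_| => [|[]].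
move=> [sK s1] [tK t1]; apply: involution_conj => //.
by rewrite !card_fix.
Qed.

Lemma rev_ord_near_matching n : near_matching (@rev_ord n).
Proof.
split; first exact: rev_ordK.
apply/card_le1_eqP => i j; rewrite !inE -!val_eqE/= => /eqP ei /eqP ej.
by apply/val_inj => /=; have := ltn_ord i; have := ltn_ord j; lia.
Qed.

(** * Reversal inside consecutive blocks of indices *)

Section TagRev.
Variables (k : nat) (p : 'I_k -> nat).

(** [sig2 x] is the offset of [x] in its block, and [Rank] turns a block and an offset back into an
    index. *)
Definition tag_rev (x : 'I_(\sum_i p i)%N) : 'I_(\sum_i p i)%N :=
  Rank _ (rev_ord (sig2 x)).

Lemma tag_rev_Rank i (u : 'I_(p i)) : tag_rev (Rank _ u) = Rank _ (rev_ord u).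
Proof.
by apply/val_inj/eqP; rewrite eq_Rank Rank2K /= Rank1K !eqxx.
Qed.

Lemma Rank_surj (x : 'I_(\sum_i p i)%N) : exists i (u : 'I_(p i)), x = Rank _ u.
Proof. by exists (sig1 x), (sig2 x); rewrite sig2K. Qed.

Lemma Rank_inj i : injective (Rank (p_ := p) i).
Proof. by move=> u v /(congr1 val)/eqP; rewrite eq_Rank eqxx => /eqP/val_inj. Qed.

Lemma tag_revK : involutive tag_rev.
Proof.
by move=> x; have [i [u ->]] := Rank_surj x; rewrite !tag_rev_Rank rev_ordK.
Qed.

(** A fixed point is the middle of a block of odd size. *)
Lemma tag_rev_near_matching :
  (#|[set i | odd (p i)]| <= 1)%N -> near_matching tag_rev.
Proof.
move=> /card_le1_eqP p1; split; first exact: tag_revK.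
have fixP x : tag_rev x = x -> exists i (u : 'I_(p i)),
    x = Rank _ u /\ (u + u).+1 = p i :> nat.
  have [i [u ->]] := Rank_surj x; rewrite tag_rev_Rank.
  move=> /Rank_inj/(congr1 val)/= eu.
  by exists i, u; split=> //; have := ltn_ord u; lia.
apply/card_le1_eqP => x y; rewrite !inE.
move=> /eqP/fixP[i [u [-> eu]]] /eqP/fixP[j [v [-> ev]]].
have odd_p l w : (w + w).+1 = p l -> l \in [set l | odd (p l)].
  by rewrite inE => <-; rewrite addnn /= odd_double.
have eij : i = j by apply: p1; [exact: odd_p ev | exact: odd_p eu].
case: _ / eij in v ev *; congr Rank; apply: val_inj => /=; lia.
Qed.
End TagRev.

(** * Matrices supported on the graph of an involution *)

Section Supported.
Variable C : numClosedFieldType.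

(** For [s] equal to [rev_ord] this is [antidiagonal]. *)
Definition supported n (s : 'I_n -> 'I_n) (A : 'M[C]_n) : Prop :=
  forall i j, j != s i -> A i j = 0.

Lemma supported_conj n (s t : 'I_n -> 'I_n) (A : 'M[C]_n) :
  near_matching s -> near_matching t -> supported s A ->
  exists w : 'S_n, supported t (row_perm w (col_perm w A)).
Proof.
(* The permuted matrix has entry [A (w i) (w j)] at [(i, j)], so [w] must carry [t] to [s]. *)
move=> sM tM As; have [w wts] := near_matching_conj tM sM.
by exists w => i j ji; rewrite !mxE As// -wts (inj_eq perm_inj).
Qed.

(** Diagonal entries vanish away from the fixed points of [s], so the entry at the only possible
    fixed point is the whole trace. *)
Lemma supported_hollow n (s : 'I_n -> 'I_n) (A : 'M[C]_n) :
  near_matching s -> supported s A -> \tr A = 0 -> hollow A.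
Proof.
move=> [_ /card_le1_eqP s1] As tA i; have [si|si] := eqVneq (s i) i; last first.
  by apply: As; rewrite eq_sym.
rewrite -tA /mxtrace (bigD1 i)//= big1 ?addr0// => j ji; apply: As.
by apply: contra_neq ji => sj; apply: s1; rewrite inE ?si// -sj.
Qed.

(* The rows and columns of A at the fixed points of s vanish; such an x is paired
   with its mirror image in the enumeration of the fixed points. *)
Lemma supported_near_matching n (s : 'I_n -> 'I_n) (A : 'M[C]_n) :
  involutive s -> hollow A -> supported s A ->
  exists t, near_matching t /\ supported t A.
Proof.
move=> sK hA As.
have [F uF inF] : exists2 F : seq 'I_n,
    uniq F & forall x, (x \in F) = (s x == x).
  exists (enum [pred x | s x == x]); first exact: enum_uniq.
  by move=> x; rewrite mem_enum.
have [m Fm] : exists m, size F = m by exists (size F).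
pose r x := nth x (rev F) (index x F).
have ltF x : s x == x -> (index x F < m)%N by rewrite -Fm index_mem inF.
have rF x : s x == x -> s (r x) == r x.
  by move=> sx; rewrite -inF -mem_rev mem_nth// size_rev Fm ltF.
have ir x : s x == x -> index (r x) F = (m - (index x F).+1)%N.
  move=> sx; rewrite /r nth_rev Fm ?ltF// index_uniq// Fm.
  by have := ltF _ sx; lia.
have F_inj x y : s x == x -> s y == y -> index x F = index y F -> x = y.
  by move=> sx sy; apply: (index_inj x); rewrite inF.
pose t x := if s x == x then r x else s x.
exists t; split; last first.
  move=> i j; rewrite /t; have [si _|_ /As//] := eqVneq (s i) i.
  have [->|ji] := eqVneq j i; first exact: hA.
  by apply: As; rewrite si.
have tE x : t x = if s x == x then r x else s x by [].
split=> [x|].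
  rewrite (tE x); case: ifP => sx; rewrite tE.
    rewrite rF//; apply: F_inj => //; rewrite ?rF//.
    by rewrite !ir ?rF//; have := ltF _ sx; lia.
  by rewrite sK eq_sym sx.
(* A fixed point of [t] must be the middle element of [F], and its index is determined by [m]. *)
have fixt x : t x == x -> s x == x /\ ((index x F).*2.+1 = m)%N.
  rewrite tE; case: ifP => [sx /eqP rx|sx]; last by rewrite sx.
  by split=> //; have := ir _ sx; rewrite rx; have := ltF _ sx; lia.
apply/card_le1_eqP => x y; rewrite !inE => /fixt[sx ix] /fixt[sy iy].
by apply: F_inj => //; lia.
Qed.

Lemma supported_mxdiag k (p : 'I_k -> nat) (B : forall i, 'M[C]_(p i)) :
  (forall i, supported (@rev_ord (p i)) (B i)) ->
  supported (@tag_rev k p) (\mxdiag_i B i).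
Proof.
move=> Bs x y; have [i [u ->]] := Rank_surj x; have [j [v ->]] := Rank_surj y.
rewrite tag_rev_Rank => nuv.
transitivity (submxblock (\mxdiag_i B i) i j u v); first by rewrite [RHS]mxE.
have [eij|nij] := eqVneq i j; last by rewrite mxblockK (negPf nij) mxE.
case: _ / eij in v nuv *; rewrite submxblock_diag Bs//.
by apply: contra_neq nuv => ->.
Qed.

(** [tag_rev] maps each block to itself, so its graph misses the off-diagonal blocks. *)
Lemma mxdiag_supported k (p : 'I_k -> nat) (A : 'M[C]_(\sum_i p i)%N) :
  supported (@tag_rev k p) A -> A = \mxdiag_i submxblock A i i.
Proof.
move=> As; apply/mxblockP => i j; have [<-|nij] := eqVneq i j.
  by rewrite submxblock_diag.
rewrite mxblockK (negPf nij); apply/matrixP => u v; rewrite !mxE As//.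
by rewrite tag_rev_Rank -val_eqE eq_Rank eq_sym (negPf nij).
Qed.

Lemma supported_submxblock k (p : 'I_k -> nat) (A : 'M[C]_(\sum_i p i)%N) i :
  supported (@tag_rev k p) A -> supported (@rev_ord (p i)) (submxblock A i i).
Proof.
move=> As u v nuv; rewrite !mxE As// tag_rev_Rank.
by apply: contra_neq nuv => /Rank_inj.
Qed.

(** In size at most 2, a position off the antidiagonal lies on the diagonal. *)
Lemma hollow_supported n (A : 'M[C]_n) :
  (n <= 2)%N -> hollow A -> supported (@rev_ord n) A.
Proof.
move=> n2 hA i j; rewrite -val_eqE/= => nij; have -> : j = i; last exact: hA.
by apply/val_inj => /=; have := ltn_ord i; have := ltn_ord j; lia.
Qed.

Lemma hollow2_hollow (a b : C) : hollow (hollow2 a b).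
Proof.
move=> i; rewrite /hollow2; case: (splitP i) => j ej.
  by have -> : i = lshift 1 j by [apply: val_inj]; rewrite block_mxEul mxE.
by have -> : i = rshift 1 j by [apply: val_inj]; rewrite block_mxEdr mxE.
Qed.

Lemma hollow2_supported (A : 'M[C]_(1 + 1)) :
  supported (@rev_ord (1 + 1)) A ->
  A = hollow2 (A (lshift 1 0) (rshift 1 0)) (A (rshift 1 0) (lshift 1 0)).
Proof.
move=> As; rewrite -[LHS]submxK /hollow2; congr block_mx;
  apply/matrixP => i j; rewrite !ord1 !mxE ?eqxx ?mulr1n//; exact: As.
Qed.

(** The new fixed point in front is the position of the leading summand [(c)] of a Q-pseudo-hollow
    matrix of odd size. *)
Definition lift_involution m (s : 'I_m -> 'I_m) (x : 'I_(1 + m)) : 'I_(1 + m) :=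
  match split x with inl y => lshift m y | inr y => rshift 1 (s y) end.

Lemma lift_involution_l m (s : 'I_m -> 'I_m) y :
  lift_involution s (lshift m y) = lshift m y.
Proof. by rewrite /lift_involution -[lshift m y]/(unsplit (inl y)) unsplitK. Qed.

Lemma lift_involution_r m (s : 'I_m -> 'I_m) y :
  lift_involution s (rshift 1 y) = rshift 1 (s y).
Proof. by rewrite /lift_involution -[rshift 1 y]/(unsplit (inr y)) unsplitK. Qed.

Lemma lift_involution_near_matching m (s : 'I_m -> 'I_m) :
  involutive s -> (forall x, s x != x) -> near_matching (lift_involution s).
Proof.
move=> sK s_free; split=> [x|].
  by case: (split_ordP x) => y ->;
    rewrite ?lift_involution_l ?lift_involution_r ?sK.
apply/card_le1_eqP => x y; rewrite !inE.
case: (split_ordP x) => x' ->; case: (split_ordP y) => y' ->;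
  rewrite ?lift_involution_l ?lift_involution_r
    ?(inj_eq (@rshift_inj _ _)) ?ord1//.
- by rewrite (negPf (s_free y')).
- by rewrite (negPf (s_free x')).
- by rewrite (negPf (s_free x')).
Qed.

Lemma supported_block m (s : 'I_m -> 'I_m) (c : C) (D : 'M[C]_m) :
  supported s D -> supported (lift_involution s) (block_mx c%:M 0 0 D).
Proof.
move=> Ds x y; case: (split_ordP x) => x' ->; case: (split_ordP y) => y' ->;
  rewrite ?lift_involution_l ?lift_involution_r ?block_mxEul ?block_mxEur
  ?block_mxEdl ?block_mxEdr ?mxE//.
  by rewrite !ord1 eqxx.
by rewrite (inj_eq (@rshift_inj _ _)); exact: Ds.
Qed.

Lemma block_supported m (s : 'I_m -> 'I_m) (A : 'M[C]_(1 + m)) :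
  supported (lift_involution s) A ->
  A = block_mx (A (lshift m 0) (lshift m 0))%:M 0 0 (drsubmx A) /\
  supported s (drsubmx A).
Proof.
move=> As; split=> [|i j nij]; last first.
  by rewrite !mxE As// lift_involution_r (inj_eq (@rshift_inj _ _)).
rewrite -[LHS]submxK; congr block_mx; apply/matrixP => i j;
  rewrite ?ord1 !mxE ?eqxx ?mulr1n//; apply: As.
  by rewrite lift_involution_l eq_rlshift.
by rewrite lift_involution_r eq_lrshift.
Qed.

End Supported.

(** * The classes of matrices up to permutation similarity *)

Section Classes.
Variable C : numClosedFieldType.

(** The classes are compared through this condition: each implies it, and it leads back to each
    after a permutation similarity, given zero trace in the hollow quasidiagonal case. *)
Definition near_matched n (A : 'M[C]_n) : Prop :=
  exists s : 'I_n -> 'I_n, near_matching s /\ supported s A.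

Lemma antidiagonal_near_matched n (A : 'M[C]_n) :
  antidiagonal A -> near_matched A.
Proof.
by move=> hA; exists (@rev_ord n); split=> //; exact: rev_ord_near_matching.
Qed.

Lemma hollow_quasidiagonal_near_matched n (A : 'M[C]_n) :
  hollow_quasidiagonal A -> near_matched A.
Proof.
move=> [hA [k [p [B [e [p2 eA]]]]]]; subst n; rewrite castmx_id in eA.
(* Each 1 x 1 block is a fixed point of [tag_rev], and there may be many; they are paired off
   because [A] is hollow. *)
apply: (supported_near_matching (s := @tag_rev k p)) => //; first exact: tag_revK.
rewrite eA; apply: supported_mxdiag => i; apply: hollow_supported.
  by have /andP[] := p2 i.
by move=> u; rewrite -(submxblock_diag B) -eA mxE.
Qed.

Lemma sum_of_hollow2_near_matched n (A : 'M[C]_n) :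
  sum_of_hollow2 A -> near_matched A.
Proof.
move=> [k [p [B [e [pB p1 eA]]]]]; subst n; rewrite eA castmx_id.
exists (@tag_rev k p); split.
  apply: tag_rev_near_matching; rewrite (_ : [set i | _] = [set i | p i == 1%N]).
    by rewrite p1 leq_b1.
  by apply/setP => i; rewrite !inE; case: (pB i) => [->|[pi2 _]]; rewrite ?pi2.
apply: supported_mxdiag => i; case: (pB i) => [pi1|[pi2 hB]].
  (* In size 1 the reversal is the identity, so an arbitrary entry is allowed. *)
  move=> u v; rewrite -val_eqE/=; have := ltn_ord u; have := ltn_ord v; lia.
by apply: hollow_supported; rewrite ?pi2.
Qed.

Lemma tag_rev2_free m (x : 'I_(\sum_(j < m) 2)%N) : tag_rev x != x.
Proof.
have [i [u ->]] := Rank_surj x; rewrite tag_rev_Rank (inj_eq (@Rank_inj _ _ _)).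
by rewrite -val_eqE/=; lia.
Qed.

Lemma Qpseudo_hollow_quasidiagonal_near_matched n (A : 'M[C]_n) :
  Qpseudo_hollow_quasidiagonal A -> near_matched A.
Proof.
have hollow2s m (a b : 'I_m -> C) :
    supported (@tag_rev m (fun=> 2%N)) (\mxdiag_(j < m) hollow2 (a j) (b j)).
  apply: supported_mxdiag => i.
  by apply: hollow_supported => //; exact: hollow2_hollow.
case=> [[m [a [b [e eA]]]]|[m [c [a [b [e eA]]]]]]; subst n; rewrite eA castmx_id.
  exists (@tag_rev m (fun=> 2%N)); split; last exact: hollow2s.
  split; first exact: tag_revK.
  by rewrite eq_card0// => x; rewrite !inE (negPf (tag_rev2_free x)).
exists (lift_involution (@tag_rev m (fun=> 2%N))); split.
  by apply: lift_involution_near_matching; [exact: tag_revK|exact: tag_rev2_free].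
exact/supported_block/hollow2s.
Qed.

Lemma near_matched_antidiagonal n (A : 'M[C]_n) : near_matched A ->
  exists w : 'S_n, antidiagonal (row_perm w (col_perm w A)).
Proof.
move=> [s [sM As]]; exact: supported_conj sM (rev_ord_near_matching n) As.
Qed.

Lemma near_matched_sum_of_hollow2 n (A : 'M[C]_n) : near_matched A ->
  exists w : 'S_n, sum_of_hollow2 (row_perm w (col_perm w A)).
Proof.
move=> [s [sM As]].
have [k [p [e p1 p12]]] : exists k (p : 'I_k -> nat),
    [/\ (\sum_i p i)%N = n, #|[set i | p i == 1%N]| = odd n
      & forall i, p i = 1%N \/ p i = 2%N].
  (* The target has one block of size 1 in front when [n] is odd, followed by [n./2] blocks of size
     2. *)
  pose p (i : 'I_(odd n + n./2)) := if split i is inl _ then 1%N else 2%N.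
  have pl i : p (lshift _ i) = 1%N
    by rewrite /p -[lshift _ _]/(unsplit (inl i)) unsplitK.
  have pr i : p (rshift _ i) = 2%N
    by rewrite /p -[rshift _ _]/(unsplit (inr i)) unsplitK.
  exists _, p; split=> [||i]; last by rewrite /p; case: split; [left|right].
    rewrite big_split_ord/=; under eq_bigr do rewrite pl.
    under [X in (_ + X)%N]eq_bigr do rewrite pr.
    by rewrite !sum_nat_const !card_ord muln1 muln2 odd_double_half.
  rewrite -sum1_card big_mkcond big_split_ord/=.
  under eq_bigr do rewrite inE pl/=.
  under [X in (_ + X)%N]eq_bigr do rewrite inE pr/=.
  by rewrite !sum_nat_const card_ord muln0 addn0 muln1.
subst n.
have tM : near_matching (@tag_rev _ p).
  apply: tag_rev_near_matching; rewrite (_ : [set i | _] = [set i | p i == 1%N]).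
    by rewrite p1 leq_b1.
  by apply/setP => i; rewrite !inE; case: (p12 i) => ->.
have [w Aw] := supported_conj sM tM As; exists w.
exists _, p, (fun i => submxblock (row_perm w (col_perm w A)) i i), erefl.
split=> //; last by rewrite castmx_id -mxdiag_supported.
move=> i; case: (p12 i) => pi; [by left|right; split=> // u].
(* The reversal of two indices has no fixed point, so the diagonal of the block vanishes. *)
apply: (supported_submxblock Aw).
by rewrite -val_eqE/=; have := ltn_ord u; lia.
Qed.

(** The block shape comes from the sum of hollow blocks; zero trace also kills the entry of the 1 x
    1 block. *)
Lemma near_matched_hollow_quasidiagonal n (A : 'M[C]_n) :
  near_matched A -> \tr A = 0 ->
  exists w : 'S_n, hollow_quasidiagonal (row_perm w (col_perm w A)).
Proof.
move=> /[dup] [[s [sM As]]] /near_matched_sum_of_hollow2[w Aw] trA.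
exists w; split.
  by move=> i; rewrite !mxE; exact: supported_hollow sM As trA _.
move: Aw => [k [p [B [e [pB _ ->]]]]]; exists k, p, B, e; split=> // i.
by case: (pB i) => [->|[pi2 _]]; rewrite ?pi2.
Qed.

Lemma near_matched_Qpseudo n (A : 'M[C]_n) : near_matched A ->
  exists w : 'S_n, Qpseudo_hollow_quasidiagonal (row_perm w (col_perm w A)).
Proof.
move=> [s [sM As]].
have blocks m (D : 'M[C]_(\sum_(j < m) 2)) :
    supported (@tag_rev m (fun=> 2%N)) D ->
    exists a b : 'I_m -> C, D = \mxdiag_(j < m) hollow2 (a j) (b j).
  move=> Ds; exists (fun j => submxblock D j j (@lshift 1 1 0) (@rshift 1 1 0)).
  exists (fun j => submxblock D j j (@rshift 1 1 0) (@lshift 1 1 0)).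
  rewrite [LHS](mxdiag_supported Ds); apply: eq_mxdiag => j.
  exact/hollow2_supported/supported_submxblock.
have e2 m : (\sum_(j < m) 2)%N = m.*2 by rewrite sum_nat_const card_ord muln2.
(* Rewriting [n] as [odd n] plus a sum of [n./2] twos gives it the shape in the definition; the odd
   case comes first, with the lifted involution as target. *)
have := odd_double_half n; rewrite -e2; move: (n./2) (odd n) => m [] /= e.
  subst n.
  have tM : near_matching (lift_involution (@tag_rev m (fun=> 2%N))).
    apply: lift_involution_near_matching;
      [exact: tag_revK|exact: tag_rev2_free].
  have [w Aw] := supported_conj sM tM As; exists w; right.
  have [eB /blocks[a [b eD]]] := block_supported Aw; rewrite eB eD.
  by exists m; eexists; exists a, b, erefl; rewrite castmx_id.
subst n.
have tM : near_matching (@tag_rev m (fun=> 2%N)).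
  split; first exact: tag_revK.
  by rewrite eq_card0// => x; rewrite !inE (negPf (tag_rev2_free x)).
have [w /blocks[a [b eD]]] := supported_conj sM tM As; exists w; left; rewrite eD.
by exists _, a, b, erefl; rewrite castmx_id.
Qed.

(** * Absorbing permutations into the similarity *)

(** With P = [perm_mx w^-1], V N V^-1 = (V P)(P^-1 N P)(V P)^-1, and P^-1 N P is the permuted [N].
    Similarity preserves the trace, so a trace condition on [M] passes to [N]. *)
Lemma similar_toW n (S : pred 'M[C]_n) (X Y : 'M[C]_n -> Prop) (M : 'M[C]_n) :
  (forall (V : 'M[C]_n) (w : 'S_n),
     S V -> V \in unitmx /\ S (V *m perm_mx w)) ->
  (forall N, \tr N = \tr M -> X N ->
     exists w : 'S_n, Y (row_perm w (col_perm w N))) ->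
  Defs.similar_to S X M -> Defs.similar_to S Y M.
Proof.
move=> SM XY [V [N [SV XN eM]]]; have [Vu _] := SM V 1%g SV.
have [|w Yw] := XY N _ XN.
  by rewrite eM mxtrace_mulC mulmxA mulVmx// mul1mx.
exists (V *m perm_mx w^-1), (row_perm w (col_perm w N)).
split=> //; first by have [] := SM V w^-1%g SV.
have -> : invmx (V *m perm_mx w^-1) = perm_mx w *m invmx V.
  rewrite -[LHS]mul1mx; apply: (canLR (mulmxK _)).
    by rewrite unitmx_mul Vu unitmx_perm.
  by rewrite mulmxA mulmxKV// -perm_mxM mulgV perm_mx1.
rewrite eM row_permE col_permE !mulmxA; congr (_ *m _).
rewrite -(mulmxA V (perm_mx _)) -perm_mxM mulVg perm_mx1 mulmx1.
by rewrite -mulmxA -perm_mxM mulVg perm_mx1 mulmx1.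
Qed.

(** Each of the five sets of matrices consists of invertible matrices and is stable under right
    multiplication by permutation matrices. *)
Lemma same_izabilityP n (X Y : 'M[C]_n -> Prop) (M : 'M[C]_n) :
  (forall N, \tr N = \tr M -> X N ->
     exists w : 'S_n, Y (row_perm w (col_perm w N))) ->
  (forall N, \tr N = \tr M -> Y N ->
     exists w : 'S_n, X (row_perm w (col_perm w N))) ->
  same_izability X Y M.
Proof.
move=> XY YX.
have orthW V (w : 'S_n) : orthogonalmx V ->
    V \in unitmx /\ orthogonalmx (V *m perm_mx w : 'M[C]_n).
  rewrite /orthogonalmx => /eqP VV; split; first by have [] := mulmx1_unit VV.
  rewrite trmx_mul tr_perm_mx mulmxA -(mulmxA V) -perm_mxM mulgV perm_mx1 mulmx1.
  by rewrite VV.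
have realP (w : 'S_n) : perm_mx w \is a mxOver (Num.real : {pred C}).
  by apply/mxOverP => i j; rewrite !mxE realn.
have sim_iff (S : pred 'M[C]_n) :
    (forall (V : 'M[C]_n) (w : 'S_n),
       S V -> V \in unitmx /\ S (V *m perm_mx w)) ->
    Defs.similar_to S X M <-> Defs.similar_to S Y M.
  by move=> SM; split; apply: similar_toW.
split; apply: sim_iff => V w.
- by move=> Vu; rewrite unitmx_mul Vu unitmx_perm.
- move=> /is_perm_mxP[v ->]; rewrite unitmx_perm -perm_mxM.
  by split=> //; exact: perm_mx_is_perm.
- move=> /andP[Vr /orthW -/(_ w)[Vu Vw]]; split=> //.
  by rewrite /real_orthogonalmx Vw andbT mxOverM.
- exact: orthW.
- move=> VU; split; first exact: spectral.unitarymx_unit.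
  apply: spectral.mul_unitarymx => //; apply/spectral.unitarymxP.
  by rewrite tr_perm_mx map_perm_mx -perm_mxM mulgV perm_mx1.
Qed.
End Classes.

Theorem corollary4p5 (R : realType) (n : nat) (M : 'M[R[i]]_n) :
  [/\ \tr M = 0 ->
        same_izability (@antidiagonal _ n) (@hollow_quasidiagonal _ n) M,
      same_izability (@antidiagonal _ n) (@Qpseudo_hollow_quasidiagonal _ n) M
    & same_izability (@antidiagonal _ n) (@sum_of_hollow2 _ n) M].
Proof.
split=> [trM||]; apply: same_izabilityP => N.
(* [N] has the trace of [M], hence trace zero. *)
- rewrite trM => trN /antidiagonal_near_matched NN.
  exact: near_matched_hollow_quasidiagonal.
- by move=> _ /hollow_quasidiagonal_near_matched/near_matched_antidiagonal.
- by move=> _ /antidiagonal_near_matched/near_matched_Qpseudo.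
- move=> _ /Qpseudo_hollow_quasidiagonal_near_matched.
  exact: near_matched_antidiagonal.
- by move=> _ /antidiagonal_near_matched/near_matched_sum_of_hollow2.
- by move=> _ /sum_of_hollow2_near_matched/near_matched_antidiagonal.
Qed.
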